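(* If $G=(V,E,T)$ is a finite terminated digraph, then $G^\infty\in\mathfrak{In}_2\text{-}\mathfrak{Out}_2$.
   Context: A terminated digraph is a triple $G=(V,E,T)$ where $(V,E)$ is a digraph and $\emptyset\ne T\subseteq V$; put $N=V\setminus T$. The digraph $G^\infty$ has as vertices all finite nonempty sequences whose last entry lies in $T$ and all of whose other entries lie in $N$; for distinct vertices $x,y$ let $\Delta(x,y)=\min\{i:x(i)\ne y(i)\}$ (entries indexed from $0$), and $(x,y)$ is an edge of $G^\infty$ iff $(x(\Delta(x,y)),y(\Delta(x,y)))\in E$. For a digraph $H$ and a set $W$ of its vertices, $H[W]$ is the induced subgraph. A set of vertices is independent if there is no edge (in either direction) between two distinct elements of it. $\mathrm{Out}^H_n(A)$ (resp. $\mathrm{In}^H_n(A)$) is the set of all vertices $v$ of $H$ such that there is a directed path of length at most $n$ from some point of $A$ to $v$ (resp. from $v$ to some point of $A$); length $0$ is allowed. $H\in\mathfrak{Out}_n$ (resp. $H\in\mathfrak{In}_n$) iff there is an independent set $A$ of vertices such that $\mathrm{Out}^H_n(A)$ (resp. $\mathrm{In}^H_n(A)$) is the whole vertex set of $H$. $H\in\mathfrak{In}_n\text{-}\mathfrak{Out}_k$ iff there is a partition $(V_1,V_2)$ of the vertex set of $H$ (parts may be empty) with $H[V_1]\in\mathfrak{In}_n$ and $H[V_2]\in\mathfrak{Out}_k$. *)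

(* Defs.v *)
From mathcomp Require Import all_boot classical_sets.

Set Implicit Arguments.
Unset Strict Implicit.
Unset Printing Implicit Defensive.

Local Open Scope classical_set_scope.

(* Loops are allowed but play no role in any notion below. *)
Record digraph := Digraph {
  vertex :> choiceType;
  edge : rel vertex
}.

Definition induced (H : digraph) (W : set H) : digraph :=
  @Digraph (set_type W) (fun x y => edge (val x) (val y)).

Definition independent (H : digraph) (A : set H) : Prop :=
  forall x y : H, A x -> A y -> x != y -> ~~ edge x y.

(* A path visits no vertex twice; its length is its number of edges. *)
Definition dipath_le (H : digraph) (n : nat) (x y : H) : Prop :=
  exists p : seq H,
    [/\ path (@edge H) x p, last x p = y, uniq (x :: p) & (size p <= n)%N].

Definition Out_ball (H : digraph) (n : nat) (A : set H) : set H :=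
  [set v | exists2 a, A a & dipath_le n a v].

Definition In_ball (H : digraph) (n : nat) (A : set H) : set H :=
  [set v | exists2 a, A a & dipath_le n v a].

Definition class_Out (n : nat) (H : digraph) : Prop :=
  exists2 A : set H, independent A & Out_ball n A = [set: H].

Definition class_In (n : nat) (H : digraph) : Prop :=
  exists2 A : set H, independent A & In_ball n A = [set: H].

Definition class_In_Out (n k : nat) (H : digraph) : Prop :=
  exists V1 V2 : set H,
    [/\ V1 `|` V2 = [set: H], V1 `&` V2 = set0,
        class_In n (induced V1) & class_Out k (induced V2)].

Record fin_terminated_digraph := FinTerminatedDigraph {
  tvertex :> finType;
  tedge : rel tvertex;
  terminal : {set tvertex};
  terminal_neq0 : terminal != finset.set0
}.

Definition is_inf_vertex (G : fin_terminated_digraph) (s : seq G) : bool :=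
  if s is v :: s' then
    (last v s' \in terminal G) && all (fun w => w \notin terminal G) (belast v s')
  else false.

Definition inf_vertex (G : fin_terminated_digraph) : Type :=
  {s : seq G | is_inf_vertex s}.

(* [onth] returns [None] past the end of a sequence. *)
Definition first_diff (V : eqType) (x y : seq V) : nat :=
  find (fun i => onth x i != onth y i) (iota 0 (maxn (size x) (size y))).

(* Two distinct vertices of G^oo are never prefixes of one another, so for
   them the default branch of the match is not reached. *)
Definition inf_edge (G : fin_terminated_digraph) (x y : inf_vertex G) : bool :=
  let d := first_diff (val x) (val y) in
  (x != y) &&
  match onth (val x) d, onth (val y) d with
  | Some a, Some b => tedge a b
  | _, _ => false
  end.

Definition infinity_digraph (G : fin_terminated_digraph) : digraph :=
  @Digraph (inf_vertex G) (@inf_edge G).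

(* Main.v *)
(* Fix [t] in [T].  By Chvatal and Lovasz, deleting [t] and its in-neighbours
   from [G] leaves a digraph with a quasi-sink [P], i.e. an independent set
   reached by every vertex in at most two steps.  If [t] sends no edge to [P],
   then [t |: P] is a quasi-sink of [G]; otherwise [P] itself is one.
   If a quasi-sink [P] of [G] meets [T], or some [z] outside [P] is not adjacent
   to [P], then the blocks of words starting with a letter of [P :\: T] are
   resolved by repeating those letters: words [u ++ r], with [u] over [P :\: T]
   and [r] starting with a suitable terminal letter or with [z], form an
   independent set reached by all of [G^oo] in at most two steps.
   Otherwise [P] is a maximal independent set disjoint from [T], with an edge
   from [t] to [P] and none from [P] to [t].  Every letter outside [P] then has
   an edge to [P], and is absorbed by [M^* (P :\: M) t] in one step, or receives
   an edge from [P], and is reached from [M^* t] in at most two steps, where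
   [M] is the part of [P] not dominated by [t]. *)
Require Import Defs.
From mathcomp Require Import all_boot classical_sets.

Set Implicit Arguments.
Unset Strict Implicit.
Unset Printing Implicit Defensive.

(** * Quasi-sinks of finite digraphs *)

(** Induction on [#|U|]: remove some [x] and its in-neighbours and take [P] for the rest. If [x]
    sends an edge to [P], the removed vertices reach [P] through [x]; otherwise [x |: P] works,
    since no remaining vertex has an edge to [x]. *)
Lemma quasi_sink_exists (V : finType) (e : rel V) (U : {set V}) :
  exists P : {set V},
    [/\ P \subset U, {in P &, forall x y, x != y -> ~~ e x y} &
        forall v, v \in U -> v \notin P ->
          exists2 p, p \in P &
            e v p \/ exists w, [/\ w \in U, e v w & e w p]].
Proof.
have [n] := ubnP #|U|; elim: n U => // n IHn U leUn.
have [->|[x xU]] := set_0Vmem U.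
  by exists finset.set0; split=> [|x y|v]; rewrite ?sub0set ?inE.
pose U' := U :\: (x |: [set y | e y x]).
have sU'U : U' \subset U by exact: finset.subsetDl.
have ltU'U : #|U'| < #|U|.
  apply/proper_card/properP; split=> //; exists x => //.
  by rewrite !inE eqxx.
have [P [sPU' indP domP]] := IHn U' (leq_trans ltU'U leUn).
have sPU := fintype.subset_trans sPU' sU'U.
have inU' v : v \in U -> v != x -> ~~ e v x -> v \in U'.
  by move=> vU vx evx; rewrite !inE negb_or vx evx vU.
have [/exists_inP[p pP exp]|/exists_inPn noP] := boolP [exists p in P, e x p].
  exists P; split=> // v vU vP.
  have [->|vx] := eqVneq v x; first by exists p; [|left].
  have [evx|evx] := boolP (e v x); first by exists p; [|right; exists x].
  have [q qP qv] := domP v (inU' v vU vx evx) vP.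
  exists q => //; case: qv => [|[w [/(fintype.subsetP sU'U) wU vw wq]]]; first by left.
  by right; exists w.
exists (x |: P); split=> [|y z|v vU].
- by rewrite finset.subUset finset.sub1set xU.
- move=> /finset.setU1P[->|yP] /finset.setU1P[->|zP]; rewrite ?eqxx //.
  + by move=> _; exact: noP.
  + move=> _; move/(fintype.subsetP sPU'): yP.
    by rewrite !inE negb_or => /andP[/andP[]].
  + exact: indP.
rewrite !inE negb_or => /andP[vx vP].
have [evx|evx] := boolP (e v x); first by exists x; [rewrite !inE eqxx|left].
have [q qP qv] := domP v (inU' v vU vx evx) vP.
exists q; first by rewrite !inE qP orbT.
case: qv => [|[w [/(fintype.subsetP sU'U) wU vw wq]]]; first by left.
by right; exists w.
Qed.

(** * Edges of $G^\infty$ as a lexicographic comparison *)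

Fixpoint lex (T : eqType) (e : rel T) (s1 s2 : seq T) : bool :=
  match s1, s2 with
  | a :: s1', b :: s2' => if a == b then lex e s1' s2' else e a b
  | _, _ => false
  end.

Lemma lexxx (T : eqType) (e : rel T) s : lex e s s = false.
Proof. by elim: s => //= a s; rewrite eqxx. Qed.

Lemma lex_head (T : eqType) (e : rel T) a b s1 s2 :
  irreflexive e -> e a b -> lex e (a :: s1) (b :: s2).
Proof. by move=> irr_e ab /=; case: eqVneq ab => // ->; rewrite irr_e. Qed.

Lemma lex_flip (T : eqType) (e : rel T) s1 s2 :
  lex (fun x y => e y x) s1 s2 = lex e s2 s1.
Proof.
by elim: s1 s2 => [|a s1 IH] [|b s2] //=; rewrite IH eq_sym.
Qed.

(** Only distinct letters are ever compared by [e], so loops may be changed freely. *)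
Lemma eq_lex (T : eqType) (e e' : rel T) s1 s2 :
  (forall x y, x != y -> e x y = e' x y) -> lex e s1 s2 = lex e' s1 s2.
Proof.
move=> ee'; elim: s1 s2 => [|a s1 IH] [|b s2] //=.
by rewrite IH; case: eqVneq => // /ee'.
Qed.

Lemma first_diff_cons (T : eqType) (a b : T) s1 s2 :
  first_diff (a :: s1) (b :: s2) =
  if a == b then (first_diff s1 s2).+1 else 0.
Proof.
rewrite /first_diff /= maxnSS /= (inj_eq (@Some_inj _)).
case: eqVneq => //= _; congr _.+1.
by rewrite (iotaDl 1 0) find_map.
Qed.

Lemma inf_edge_lex (G : fin_terminated_digraph) (x y : inf_vertex G) :
  inf_edge x y = lex (@tedge G) (val x) (val y).
Proof.
rewrite /inf_edge -val_eqE; case: x y => [s1 _] [s2 _] /=.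
elim: s1 s2 => [|a s1 IH] [|b s2] //=.
rewrite first_diff_cons eqseq_cons; case: eqVneq => //= _.
Qed.

Lemma is_inf_vertex_cons (G : fin_terminated_digraph) (a : G) s :
  a \notin terminal G -> is_inf_vertex (a :: s) = is_inf_vertex s.
Proof.
case: s => [|b s] aN /=; first by rewrite (negPf aN).
by rewrite aN.
Qed.

Lemma is_inf_vertex_terminal (G : fin_terminated_digraph) (a : G) s :
  a \in terminal G -> is_inf_vertex (a :: s) -> s = [::].
Proof. by case: s => // b s aT /=; rewrite aT andbF. Qed.

Lemma is_inf_vertex_head (G : fin_terminated_digraph) (a : G) :
  exists s, is_inf_vertex (a :: s).
Proof.
have /set0Pn[t tT] := terminal_neq0 G.
have [aT|aN] := boolP (a \in terminal G); first by exists [::]; rewrite /= aT.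
by exists [:: t]; rewrite is_inf_vertex_cons //= tT.
Qed.

(** * Domination within two steps, from words to induced subgraphs *)

(** Kept on raw words and generic in [e]: reversing [e] turns the notion behind [class_In] into the
    one behind [class_Out]. *)
Definition covers (G : fin_terminated_digraph) (e : rel G)
    (V A : pred (seq G)) (s : seq G) : Prop :=
  exists a, [/\ is_inf_vertex a, A a &
    [\/ s = a, lex e s a |
        exists b, [/\ is_inf_vertex b, V b, lex e s b & lex e b a]]].

Definition lex_independent (G : fin_terminated_digraph) (e : rel G)
    (A : pred (seq G)) : Prop :=
  forall s1 s2, is_inf_vertex s1 -> is_inf_vertex s2 ->
    A s1 -> A s2 -> ~~ lex e s1 s2.

Definition inf_set (G : fin_terminated_digraph) (V : pred (seq G)) :
  set (infinity_digraph G) := [set x | V (val x)]%classic.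

Lemma edge_induced_lex (G : fin_terminated_digraph) (V : pred (seq G))
    (x y : induced (inf_set V)) :
  edge x y = lex (@tedge G) (val (val x)) (val (val y)).
Proof. exact: inf_edge_lex. Qed.

Lemma lex_independent_induced (G : fin_terminated_digraph)
    (V A : pred (seq G)) :
  lex_independent (@tedge G) A ->
  independent [set x : induced (inf_set V) | A (val (val x))]%classic.
Proof.
move=> indA x y Ax Ay _; rewrite edge_induced_lex.
by apply: indA => //; exact: valP (val _).
Qed.

Lemma dipath_le2 (H : digraph) (x y z : H) :
  uniq [:: x; y; z] -> edge x y -> edge y z -> dipath_le 2 x z.
Proof. by move=> u xy yz; exists [:: y; z]; rewrite /= xy yz. Qed.

Lemma dipath_le1 (H : digraph) (x y : H) :
  x != y -> edge x y -> dipath_le 2 x y.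
Proof. by move=> nxy xy; exists [:: y]; rewrite /= xy inE nxy. Qed.

Lemma covers_induced (G : fin_terminated_digraph) (e : rel G)
    (V A : pred (seq G)) (x : induced (inf_set V)) :
  (forall s, is_inf_vertex s -> A s -> V s) ->
  (forall s, is_inf_vertex s -> V s -> covers e V A s) ->
  exists2 a : induced (inf_set V), A (val (val a)) &
    [\/ x = a,
        x != a /\ lex e (val (val x)) (val (val a)) |
        exists b : induced (inf_set V), [/\ uniq [:: x; b; a],
          lex e (val (val x)) (val (val b)) &
          lex e (val (val b)) (val (val a))]].
Proof.
move=> sAV covA.
have lift s : is_inf_vertex s -> V s ->
    exists y : induced (inf_set V), val (val y) = s.
  move=> sP sV; have yV : (exist _ s sP : infinity_digraph G) \in inf_set V.
    by rewrite in_setE.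
  by exists (SigSub yV).
have Vx : V (val (val x)) by have := valP x; rewrite in_setE.
have [a0 [aP Aa xa]] := covA _ (valP (val x)) Vx.
have [a aE] := lift a0 aP (sAV a0 aP Aa).
rewrite -{a0 aP}aE in Aa xa; exists a => //.
have neq (y z : induced (inf_set V)) :
    lex e (val (val y)) (val (val z)) -> y != z.
  by apply: contraTneq => ->; rewrite lexxx.
(* Paths may not repeat a vertex: a closed walk [x], [b], [x] is replaced by the path of length
   0. *)
have [->|nxa] := eqVneq x a; first by constructor 1.
case: xa => [xa|xa|[b0 [bP Vb xb ba]]].
- by constructor 1; do 2![apply: val_inj].
- by constructor 2.
- have [b bE] := lift b0 bP Vb; rewrite -{}bE in xb ba.
  constructor 3; exists b.
  by rewrite /= !inE negb_or nxa !neq.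
Qed.

Lemma class_In_covers (G : fin_terminated_digraph) (V A : pred (seq G)) :
  (forall s, is_inf_vertex s -> A s -> V s) ->
  lex_independent (@tedge G) A ->
  (forall s, is_inf_vertex s -> V s -> covers (@tedge G) V A s) ->
  class_In 2 (induced (inf_set V)).
Proof.
move=> sAV indA covA; eexists; first exact: lex_independent_induced indA.
apply/seteqP; split=> // x _.
have [a Aa xa] := covers_induced x sAV covA; exists a => //.
case: xa => [->|[nxa xa]|[b [u xb ba]]].
- by exists [::].
- by apply: dipath_le1; rewrite ?edge_induced_lex.
- by apply: (@dipath_le2 _ _ b); rewrite ?edge_induced_lex.
Qed.

Lemma class_Out_covers (G : fin_terminated_digraph) (V A : pred (seq G)) :
  (forall s, is_inf_vertex s -> A s -> V s) ->
  lex_independent (@tedge G) A ->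
  (forall s, is_inf_vertex s -> V s ->
    covers (fun x y => @tedge G y x) V A s) ->
  class_Out 2 (induced (inf_set V)).
Proof.
move=> sAV indA covA; eexists; first exact: lex_independent_induced indA.
apply/seteqP; split=> // x _.
have [a Aa xa] := covers_induced x sAV covA; exists a => //.
case: xa => [->|[nxa]|[b [u]]]; rewrite ?(lex_flip (@tedge G)).
- by exists [::].
- by move=> ax; apply: dipath_le1; rewrite ?edge_induced_lex // eq_sym.
- move=> bx ab; apply: (@dipath_le2 _ _ b); rewrite ?edge_induced_lex //.
  by rewrite -(rev_uniq [:: x; b; a]) in u.
Qed.

(** * Words with a prefix over a set of letters *)

(** [S (strip M s)] encodes $s\in M^*S$ when no word of [S] begins in [M]. *)
Fixpoint strip (T : finType) (M : {set T}) (s : seq T) : seq T :=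
  if s is a :: s' then if a \in M then strip M s' else s else [::].

(** While both words run through [M], a first difference falls under the independence of [M]. If one
    [M]-prefix ends first, the next letter there is not adjacent to [M]; if both end together, the
    remainders are compared in [S]. *)
Lemma strip_independent (G : fin_terminated_digraph) (e : rel G)
    (M : {set G}) (S : pred (seq G)) :
  M \subset ~: terminal G ->
  {in M &, forall a b, a != b -> ~~ e a b} ->
  (forall a b s, a \in M -> b \notin M -> S (b :: s) -> ~~ e a b && ~~ e b a) ->
  lex_independent e S ->
  lex_independent e (fun s => S (strip M s)).
Proof.
move=> sMN indM indMS indS.
elim=> [|a s1 IH] [|b s2] // s1P s2P /=.
have MN c : c \in M -> c \notin terminal G.
  by move=> /(fintype.subsetP sMN); rewrite inE.
have [aM|aM] := boolP (a \in M); have [bM|bM] := boolP (b \in M).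
- move=> A1 A2; case: eqVneq => [_|]; last exact: indM.
  by apply: IH => //; [rewrite -(is_inf_vertex_cons _ (MN _ aM))|
    rewrite -(is_inf_vertex_cons _ (MN _ bM))].
- case: eqVneq => [ab|_]; first by rewrite -ab aM in bM.
  by move=> _ /(indMS _ _ _ aM bM)/andP[].
- case: eqVneq => [ab|_]; first by rewrite ab bM in aM.
  by move=> /(indMS _ _ _ bM aM)/andP[].
- by move=> A1 A2; exact: (indS _ _ s1P s2P).
Qed.

(** A common first letter does not affect an edge, so a covering path can be prefixed by letters of
    [M]. *)
Lemma strip_covers (G : fin_terminated_digraph) (e : rel G)
    (M : {set G}) (X S : pred (seq G)) :
  M \subset ~: terminal G ->
  (forall a s, is_inf_vertex (a :: s) -> a \notin M -> X (a :: s) ->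
    covers e (fun s => X (strip M s)) (fun s => S (strip M s)) (a :: s)) ->
  forall s, is_inf_vertex s -> X (strip M s) ->
    covers e (fun s => X (strip M s)) (fun s => S (strip M s)) s.
Proof.
move=> sMN cov; elim=> // a s IH sP /=.
case: ifPn => [aM Xs|aM Xs]; last exact: cov.
have aN : a \notin terminal G by have:= fintype.subsetP sMN a aM; rewrite inE.
rewrite is_inf_vertex_cons // in sP.
have [c [cP Ac sc]] := IH sP Xs.
exists (a :: c); rewrite is_inf_vertex_cons //= aM eqxx; split=> //.
case: sc => [->|sc|[b [bP Vb sb bc]]]; [by constructor 1|by constructor 2|].
constructor 3; exists (a :: b).
by rewrite is_inf_vertex_cons //= aM eqxx.
Qed.

(** * The two ways of splitting $G^\infty$ *)

Lemma class_In_Out_covers (G : fin_terminated_digraph)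
    (V A1 A2 : pred (seq G)) (e : rel G) :
  (forall x y, x != y -> tedge x y = e x y) ->
  (forall s, is_inf_vertex s -> A1 s -> V s) ->
  (forall s, is_inf_vertex s -> A2 s -> ~~ V s) ->
  lex_independent e A1 -> lex_independent e A2 ->
  (forall s, is_inf_vertex s -> V s -> covers e V A1 s) ->
  (forall s, is_inf_vertex s -> ~~ V s ->
    covers (fun x y => e y x) (fun s => ~~ V s) A2 s) ->
  class_In_Out 2 2 (infinity_digraph G).
Proof.
move=> eE sA1 sA2 indA1 indA2 cov1 cov2.
have lexE s1 s2 : lex (@tedge G) s1 s2 = lex e s1 s2 by exact: eq_lex.
exists (inf_set V), (inf_set (fun s => ~~ V s)); split.
- by apply/seteqP; split=> // x _; rewrite /inf_set /=; case: (V _); [left|right].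
- by apply/seteqP; split=> // x []; rewrite /inf_set /= => ->.
- apply: class_In_covers sA1 _ _ => [s1 s2|s sP Vs].
    by rewrite lexE; exact: indA1.
  have [a [aP Aa sa]] := cov1 s sP Vs; exists a; split=> //.
  case: sa => [->|sa|[b [bP Vb sb ba]]].
  + by constructor 1.
  + by constructor 2; rewrite lexE.
  + by constructor 3; exists b; rewrite !lexE.
- apply: class_Out_covers sA2 _ _ => [s1 s2|s sP Vs].
    by rewrite lexE; exact: indA2.
  have [a [aP Aa sa]] := cov2 s sP Vs; exists a; split=> //.
  case: sa => [->|sa|[b [bP Vb sb ba]]].
  + by constructor 1.
  + by constructor 2; rewrite (lex_flip (@tedge G)) lexE -(lex_flip e).
  + constructor 3; exists b.
    by rewrite !(lex_flip (@tedge G)) !lexE -!(lex_flip e).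
Qed.

(* The independent set consists of the words [u ++ r] with [u] over [P :\: T]
   and [r] either equal to [z :: y] or a single letter of [P :&: T]. *)
Lemma class_In_Out_sink (G : fin_terminated_digraph) (e : rel G)
    (P : {set G}) (z : G) (y : seq G) :
  (forall x y, x != y -> tedge x y = e x y) -> irreflexive e ->
  {in P &, forall p q, p != q -> ~~ e p q} ->
  (forall v, v \notin P ->
    exists2 p, p \in P & e v p \/ exists w, e v w /\ e w p) ->
  z \notin P :\: terminal G ->
  {in P, forall p, ~~ e p z && ~~ e z p} ->
  is_inf_vertex (z :: y) ->
  class_In_Out 2 2 (infinity_digraph G).
Proof.
move=> eE irr_e indP sinkP zM adjz zyP; set M := P :\: terminal G in zM.
(* The default of [head] is harmless: a word ends in $T$, hence outside [M], and its [strip] is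
   nonempty. *)
pose S (r : seq G) := (r == z :: y) || (head z r \in P :&: terminal G).
have sMN : M \subset ~: terminal G.
  by apply/fintype.subsetP => p; rewrite inE finset.in_setC => /andP[].
have sMP p : p \in M -> p \in P by rewrite inE => /andP[].
have indM : {in M &, forall p q, p != q -> ~~ e p q}.
  by move=> p q /sMP pP /sMP; exact: indP.
have indS : lex_independent e (fun s => S (strip M s)).
  apply: strip_independent => //.
    move=> a b s aM bM /orP[/eqP[-> _]|/finset.setIP[/= bP _]].
      exact/adjz/sMP.
    have ab : a != b by apply: contraNneq bM => <-.
    by rewrite !indP ?(sMP _ aM) // eq_sym.
  move=> [|a s1] // [|b s2] // s1P s2P /orP[/eqP E1|/finset.setIP[/= aP aT]].
    rewrite E1; move=> /orP[/eqP->|/finset.setIP[/= bP bT]].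
      by rewrite lexxx.
    rewrite /=; case: eqVneq => [zb|_]; last by case/andP: (adjz b bP).
    by rewrite (is_inf_vertex_terminal bT s2P); case: (y).
  rewrite (is_inf_vertex_terminal aT s1P) /=.
  case: eqVneq => [//|ab] /orP[/eqP[-> _]|/finset.setIP[/= bP _]].
    by case/andP: (adjz a aP).
  exact: indP.
(* The second part of the partition is empty. *)
apply: (@class_In_Out_covers G predT (fun s => S (strip M s)) pred0 e eE) => //.
move=> s sP _; apply: (strip_covers (X := predT)) sP _ => // a {}s asP aM _.
have [aP|aP] := boolP (a \in P).
  exists (a :: s); split=> //; last by constructor 1.
  have aT : a \in terminal G by move: aM; rewrite inE aP andbT negbK.
  by rewrite /= (negPf aM) /S /= inE aP aT orbT.
have [p pP ap] := sinkP a aP.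
(* The word [p :: u] is [[:: p]] if [p] is terminal, and [[:: p, z & y]] with [p] in [M]
   otherwise. *)
have [u upP Su] : exists2 u, is_inf_vertex (p :: u) & S (strip M (p :: u)).
  have [pT|pN] := boolP (p \in terminal G).
    by exists [::]; rewrite /= ?pT // inE pT /= /S /= inE pP pT orbT.
  exists (z :: y); first by rewrite is_inf_vertex_cons.
  by rewrite /= inE pN pP (negPf zM) /S eqxx.
exists (p :: u); split=> //; case: ap => [ap|[w [aw wp]]].
  by constructor 2; exact: lex_head.
have [v wvP] := is_inf_vertex_head w.
by constructor 3; exists (w :: v); split=> //; exact: lex_head.
Qed.

(* With [M] the set of the [p] in [P] such that [~~ e t p], the two independent
   sets are [M^* (P :\: M) t] and [M^* t]. *)
Lemma class_In_Out_maximal (G : fin_terminated_digraph) (e : rel G)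
    (P : {set G}) (t p0 : G) :
  (forall x y, x != y -> tedge x y = e x y) -> irreflexive e ->
  {in P &, forall p q, p != q -> ~~ e p q} ->
  P \subset ~: terminal G ->
  t \in terminal G -> p0 \in P -> e t p0 ->
  {in P, forall p, ~~ e p t} ->
  (forall v, v \notin P -> exists2 p, p \in P & e v p || e p v) ->
  class_In_Out 2 2 (infinity_digraph G).
Proof.
move=> eE irr_e indP sPN tT p0P tp0 Pt maxP.
have PN p : p \in P -> p \notin terminal G.
  by move=> /(fintype.subsetP sPN); rewrite finset.in_setC.
pose M := [set p in P | ~~ e t p].
have sMP p : p \in M -> p \in P by rewrite inE => /andP[].
have tp p : p \in P -> p \notin M -> e t p.
  by move=> pP; rewrite inE pP negbK.
have sMN : M \subset ~: terminal G.
  by apply/fintype.subsetP => p /sMP pP; rewrite finset.in_setC PN.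
have indM : {in M &, forall p q, p != q -> ~~ e p q}.
  by move=> p q /sMP pP /sMP; exact: indP.
have tP : t \notin P by apply: contraL tT => /PN.
have tM : t \notin M by apply: contra tP => /sMP.
have p0M : p0 \notin M by rewrite inE p0P tp0.
have wt : is_inf_vertex [:: t] by rewrite /= tT.
have wpt p : p \in P -> is_inf_vertex [:: p; t].
  by move=> /PN pN; rewrite is_inf_vertex_cons.
pose S1 (r : seq G) := (r == [:: head t r; t]) && (head t r \in P).
pose S2 (r : seq G) := r == [:: t].
(* [X] describes the first part of the partition, once the prefix over [M] is stripped. *)
pose X (r : seq G) := S1 r ||
  [&& head t r \notin P, head t r != t & [exists p in P, e (head t r) p]].
have nX1 s : S2 s -> ~~ X s.
  by move=> /eqP->; rewrite /X /S1 /= (negPf tP) eqxx andbF.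
apply: (@class_In_Out_covers G (fun s => X (strip M s))
  (fun s => S1 (strip M s)) (fun s => S2 (strip M s)) e eE).
- by move=> s _; rewrite /X => ->.
- by move=> s _; exact: nX1.
- apply: strip_independent => //.
    move=> a b s aM bM /andP[_ /= bP].
    have ab : a != b by apply: contraNneq bM => <-.
    by rewrite !indP ?(sMP _ aM) // eq_sym.
  move=> [|a s1] // [|b s2] // _ _ /andP[/eqP[->] /= aP] /andP[/eqP[->] /= bP].
  by rewrite eqxx; case: eqVneq => //; exact: indP.
- apply: strip_independent => //.
    move=> a b s aM bM /eqP[-> _]; rewrite Pt ?sMP //.
    by move: aM; rewrite inE => /andP[].
  by move=> s1 s2 _ _ /eqP-> /eqP->; rewrite lexxx.
- apply: strip_covers => // a s asP aM.
  case/orP=> [S1s|/and3P[/= aP at_ /exists_inP[p pP ap]]].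
    by exists (a :: s); split=> //; [rewrite /= (negPf aM)|constructor 1].
  (* For [p] in [M] the word [[:: p; t]] is not in $M^*(P\setminus M)t$; inserting [p0], which lies
     outside [M], repairs this. *)
  have [pM|pM] := boolP (p \in M).
    exists [:: p; p0; t]; split; last by constructor 2; exact: lex_head.
      by rewrite is_inf_vertex_cons ?wpt // PN.
    by rewrite /= pM (negPf p0M) /S1 /= eqxx.
  exists [:: p; t]; split; last by constructor 2; exact: lex_head.
    exact: wpt.
  by rewrite /= (negPf pM) /S1 /= eqxx.
- apply: (strip_covers (X := fun s => ~~ X s)) => // a s asP aM.
  have At : S2 (strip M [:: t]) by rewrite /= (negPf tM) /S2.
  have lexr b u v : e b a -> lex (fun x y => e y x) (a :: u) (b :: v).
    by move=> ba; apply: lex_head.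
  rewrite negb_or => /andP[nS1]; rewrite /= !negb_and !negbK => nX.
  have [aE|at_] := eqVneq a t.
    exists [:: t]; split=> //; constructor 1.
    by rewrite aE in asP *; rewrite (is_inf_vertex_terminal tT asP).
  have [aP|aP] := boolP (a \in P).
    by exists [:: t]; split=> //; constructor 2; exact/lexr/tp.
  rewrite (negPf aP) (negPf at_) /= in nX.
  have [p pP /orP[ap|pa]] := maxP a aP.
    by case/exists_inP: nX; exists p.
  have [pM|pM] := boolP (p \in M).
    exists [:: p; t]; split; [exact: wpt| |by constructor 2; exact: lexr].
    by rewrite /= pM (negPf tM) /S2.
  (* The path runs from [t] through a word starting with [p]. As [[:: p; t]] belongs to the first
     part, the longer [[:: p; p0; t]] is used. *)
  exists [:: t]; split=> //; constructor 3; exists [:: p; p0; t]; split.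
  + by rewrite is_inf_vertex_cons ?wpt // PN.
  + by rewrite /= (negPf pM) /X /S1 /= pP !eqseq_cons !andbF.
  + exact: lexr.
  + by apply: lex_head => //; exact: tp.
Qed.

(** * Case distinction on the quasi-sink *)

Theorem theorem5p5 (G : fin_terminated_digraph) :
  class_In_Out 2 2 (infinity_digraph G).
Proof.
have /set0Pn[t tT] := terminal_neq0 G.
(* Removing loops makes [e] irreflexive without changing the edges of $G^\infty$. *)
pose e := [rel x y : G | (x != y) && tedge x y].
have eE x y : x != y -> tedge x y = e x y by rewrite /= => ->.
have irr_e : irreflexive e by move=> x; rewrite /= eqxx.
pose U := ~: (t |: [set x | e x t]).
have [P [sPU indP domP]] := quasi_sink_exists e U.
have PNt p : p \in P -> (p != t) && ~~ e p t.
  by move/(fintype.subsetP sPU); rewrite !inE negb_or.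
have [/exists_inP[p0 p0P tp0]|/exists_inPn tP] := boolP [exists p in P, e t p];
    last first.
  have tsink v : v \notin t |: P -> exists2 p, p \in t |: P &
      e v p \/ exists w, e v w /\ e w p.
    rewrite in_setU1 negb_or => /andP[vt vP].
    have [vt'|vt'] := boolP (e v t).
      by exists t; [exact: setU11|left].
    have vU : v \in U by rewrite finset.in_setC in_setU1 negb_or vt inE.
    have [p pP vp] := domP v vU vP; exists p; first exact: setU1r.
    by case: vp => [|[w [_ vw wp]]]; [left|right; exists w].
  apply: (class_In_Out_sink eE irr_e _ tsink (z := t) (y := [::])) => //.
  - move=> p q /finset.setU1P[->|pP] /finset.setU1P[->|qP]; rewrite ?eqxx //.
    + by move=> _; exact: tP.
    + by move=> _; case/andP: (PNt p pP).
    + exact: indP.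
  - by rewrite finset.in_setD tT.
  - move=> p /finset.setU1P[->|pP]; first by rewrite /= eqxx.
    by rewrite tP //; case/andP: (PNt p pP) => _ ->.
  - by rewrite /= tT.
(* The deleted in-neighbours of [t] reach [p0] through [t]. *)
have sinkP v : v \notin P -> exists2 p, p \in P &
    e v p \/ exists w, e v w /\ e w p.
  move=> vP; have [vU|] := boolP (v \in U).
    have [p pP vp] := domP v vU vP; exists p => //.
    by case: vp => [|[w [_ vw wp]]]; [left|right; exists w].
  rewrite finset.in_setC negbK in_setU1 finset.in_set => /orP[/eqP->|vt].
    by exists p0; [|left].
  by exists p0; [|right; exists t].
have [sPN|/subsetPn[z zP]] := boolP (P \subset ~: terminal G); last first.
  rewrite finset.in_setC negbK => zT.
  apply: (class_In_Out_sink eE irr_e indP sinkP (z := z) (y := [::])).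
  - by rewrite finset.in_setD zT.
  - move=> p pP; have [->|npz] := eqVneq p z; first by rewrite /= eqxx.
    by rewrite !indP // eq_sym.
  - by rewrite /= zT.
have [/forall_inP maxP|/forall_inPn[z zP zadj]] :=
    boolP [forall v in ~: P, [exists p in P, e v p || e p v]].
  apply: (class_In_Out_maximal eE irr_e indP sPN tT p0P tp0).
    by move=> p /PNt/andP[].
  by move=> v vP; apply/exists_inP/maxP; rewrite finset.in_setC.
(* Here [z] may be nonterminal, so it is first completed to a word. *)
have [y zyP] := is_inf_vertex_head z.
apply: (class_In_Out_sink eE irr_e indP sinkP _ _ zyP).
  by rewrite finset.in_setD; move: zP; rewrite finset.in_setC => /negPf->; rewrite andbF.
move=> p pP; rewrite -negb_or orbC.
by apply: contra zadj => zp; apply/exists_inP; exists p.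
Qed.
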